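(* Let $H_{\operatorname{paw}}$ be the paw graph, i.e. the graph on four vertices obtained from a triangle by adding one new vertex joined by an edge to exactly one vertex of the triangle. Then \[ t_{\operatorname{ind}}(H_{\operatorname{paw}}) = \max_{w \in \mathcal{W}} t_{\operatorname{ind}}(H_{\operatorname{paw}};w) = \frac{1}{32}. \]
   Context: A graphon is a measurable symmetric function $w:[0,1]^2 \to [0,1]$; $\mathcal{W}$ denotes the set of all graphons. For a finite graph $H$ and a graphon $w$, let $\{x_u : u \in V(H)\}$ be independent random variables uniformly distributed on $[0,1]$, and define the induced homomorphism density \[ t_{\operatorname{ind}}(H;w) = \mathbb{E}\left[\prod_{\{u,v\} \in E(H)} w(x_u,x_v) \prod_{\{u,v\} \notin E(H),\, u \neq v} (1 - w(x_u,x_v))\right], \] where the second product is over unordered pairs of distinct vertices that are not edges. Define $t_{\operatorname{ind}}(H) = \max_{w \in \mathcal{W}} t_{\operatorname{ind}}(H;w)$ (the maximum is attained). This quantity equals $\frac{|\mathrm{Aut}(H)|}{|V(H)|!}\, i(H)$, where $i(H) = \lim_{n\to\infty} \max_{|V(G)|=n} I(H;G)/\binom{n}{|V(H)|}$ is the inducibility of $H$ and $I(H;G)$ is the number of induced subgraphs of $G$ isomorphic to $H$. *)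

(* Defs.v *)
From HB Require Import structures.
From mathcomp Require Import all_boot all_order all_algebra.
From mathcomp Require Import all_classical all_reals all_analysis.
Set Implicit Arguments.
Unset Strict Implicit.
Unset Printing Implicit Defensive.
Import Order.TTheory GRing.Theory Num.Theory.
Local Open Scope classical_set_scope.
Local Open Scope ring_scope.

Record sgraph := SGraph {
  vertex :> finType;
  adj : rel vertex;
  adj_sym : symmetric adj;
  adj_irrefl : irreflexive adj }.

(* The triangle is {0, 1, 2}; the pendant vertex 3 hangs from 2. *)
Definition paw_edges : seq (nat * nat) :=
  [:: (0, 1); (0, 2); (1, 2); (2, 3)]%N.

Definition paw_adj : rel 'I_4 := fun u v =>
  ((u : nat, v : nat) \in paw_edges) || ((v : nat, u : nat) \in paw_edges).

Lemma paw_adj_sym : symmetric paw_adj.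
Proof. by move=> u v; rewrite /paw_adj orbC. Qed.

Lemma paw_adj_irrefl : irreflexive paw_adj.
Proof. by case=> -[|[|[|[|]]]]. Qed.

Definition paw : sgraph := SGraph paw_adj_sym paw_adj_irrefl.

Section IidProbability.
Context d (T : measurableType d) (R : realType) (P : probability T R).

Definition cons_pair n (p : T * n.-tuple T) : n.+1.-tuple T :=
  [tuple of p.1 :: p.2].

Lemma measurable_cons_pair n : measurable_fun [set: _] (@cons_pair n).
Proof. exact: measurable_cons. Qed.

HB.instance Definition _ n :=
  isMeasurableFun.Build _ _ _ _ (@cons_pair n) (@measurable_cons_pair n).

Fixpoint iid_prob (n : nat) : probability (n.-tuple T) R :=
  match n with
  | 0 => \d_[tuple]
  | n'.+1 => distribution (P \x iid_prob n')%E (@cons_pair n')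
  end.

(* Under [iid_prob n] the n coordinates are mutually independent, each with
   law [P]. *)
Lemma iid_prob_box n (A : 'I_n -> set T) :
  (forall i, measurable (A i)) ->
  iid_prob n [set t | forall i, A i (tnth t i)] = (\prod_(i < n) P (A i))%E.
Proof.
elim: n A => [|n IH] A mA /=.
  by rewrite big_ord0 diracE mem_set// => -[].
have mB : measurable [set t : n.-tuple T | forall i, A (lift ord0 i) (tnth t i)].
  rewrite (_ : [set _ | _] =
      \bigcap_(i in [set: 'I_n]) ((@tnth _ T ^~ i) @^-1` A (lift ord0 i))).
    apply: fin_bigcap_measurable => // i _.
    by rewrite -[X in measurable X]setTI; exact: measurable_tnth.
  by apply/seteqP; split=> t /= h i *; exact: h.
rewrite big_ord_recl -IH// -product_measure1E//.
rewrite /distribution /pushforward; congr (_ _).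
apply/seteqP; split=> [[x t] h|[x t] [h1 h2] i] /=.
  split=> [|i]; first by have := h ord0; rewrite tnth0.
  by have := h (lift ord0 i); rewrite /= tnthS.
by case: (unliftP ord0 i) => [j|] ->; rewrite ?tnthS ?tnth0//; exact: h2.
Qed.

End IidProbability.

Section Graphons.
Variable R : realType.

Definition unit_square : set (R * R) := `[0, 1] `*` `[0, 1].

(* A graphon is a function on [unit_square]: its values elsewhere are
   irrelevant. *)
Definition graphon : set (R * R -> R) := [set w : R * R -> R |
  [/\ measurable_fun unit_square w,
      (forall x y, unit_square (x, y) -> w (x, y) = w (y, x)) &
      (forall p, unit_square p -> 0 <= w p <= 1)]].

Definition extend0 (w : R * R -> R) : R * R -> R :=
  patch (fun=> 0) unit_square w.

(* Each unordered pair of distinct vertices is represented once, by the pair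
   [e] with [enum_rank e.1 < enum_rank e.2]; as [w] is symmetric, the choice
   of the orientation is immaterial. *)
Definition ind_weight (H : sgraph) (w : R * R -> R) (x : H -> R) : R :=
  (\prod_(e : H * H | (enum_rank e.1 < enum_rank e.2)%N && adj e.1 e.2)
     w (x e.1, x e.2)) *
  (\prod_(e : H * H | (enum_rank e.1 < enum_rank e.2)%N && ~~ adj e.1 e.2)
     (1 - w (x e.1, x e.2))).

(* The sampled points lie in [0, 1] almost surely, so that [extend0] is
   immaterial. *)
Definition t_ind (H : sgraph) (w : R * R -> R) : \bar R :=
  ('E_(iid_prob (uniform_prob (@ltr01 R)) #|H|)
     [fun t => ind_weight (extend0 w) (fun u : H => tnth t (enum_rank u))])%E.

(* The maximum over all graphons, defined as a supremum; attainment is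
   expressed separately by [is_max]. *)
Definition max_t_ind (H : sgraph) : \bar R := ereal_sup (t_ind H @` graphon).

Definition is_max (A : set (\bar R)) (m : \bar R) := A m /\ ubound A m.

End Graphons.

(* Main.v *)
(** The bound first holds for finite graphs: a graph on [n] vertices has at most
    [n ^ 4 / 32] labelled induced paws. This is a flag-algebra argument on five
    vertices: the constant 1/32 minus the indicator of a paw minus a combination
    of seven squares becomes nonnegative on every graph once averaged over the
    relabellings of the five vertices. The count over injective quadruples is
    affine in the weight of each edge, so the bound extends to edge weights
    between 0 and 1. Sampling [n] points from a graphon gives such a weighted
    graph, whose expected count is [n (n - 1) (n - 2) (n - 3)] times the induced
    density; let [n] tend to infinity. Equality holds for the complement of two
    disjoint balanced complete bipartite graphons. *)
From Stdlib Require Import ZArith.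
Require Import Defs.
From HB Require Import structures.
From mathcomp Require Import all_boot all_order all_algebra.
From mathcomp Require Import all_classical all_reals all_analysis.
From mathcomp Require Import measurable_realfun ssrZ zify ring lra.
Set Implicit Arguments.
Unset Strict Implicit.
Unset Printing Implicit Defensive.
Import Order.TTheory GRing.Theory Num.Theory.
Local Open Scope classical_set_scope.
Local Open Scope ring_scope.

(** * The certificate on five vertices *)

(* A graph on the vertices 0, ..., 4 is encoded by its ten adjacency bits, in
   the order of [pairs5]. *)
Definition pairs5 : seq (nat * nat) :=
  [:: (0, 1); (0, 2); (1, 2); (0, 3); (1, 3); (2, 3);
      (0, 4); (1, 4); (2, 4); (3, 4)]%N.

Definition pair_index (i j : nat) : nat :=
  index (if (i < j)%N then (i, j) else (j, i)) pairs5.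

(** Renaming the vertices by [s] permutes the ten bits; this lists, for each new bit, the old
    position it is read from. *)
Definition relabelling (s : seq nat) : seq nat :=
  [seq pair_index (nth 0%N s p.1) (nth 0%N s p.2) | p <- pairs5].

Definition relabellings : seq (seq nat) :=
  [seq relabelling s | s <- permutations (iota 0 5)].

Section Certificate.
Local Open Scope Z_scope.

(* The forms of a vertex that is adjacent to 0, 1, 2 according to [a], [b], [c],
   where 0, 1, 2 induce respectively no edge, the edge 12 only, and the cherry
   centred at 2. All coefficients come from a semidefinite programme, rounded to
   rationals. *)
Definition cotriangle_form1 (a b c : bool) : Z :=
  match a, b, c with
  | true, false, false | false, true, false | false, false, true => 1
  | false, true, true | true, false, true | true, true, false => -1
  | _, _, _ => 0
  end.
Definition cotriangle_form2 (a b c : bool) : Z :=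
  match a, b, c with
  | false, true, true => 8 | true, false, true => -8
  | true, false, false => 1 | false, true, false => -1
  | _, _, _ => 0
  end.
Definition edge_form (a b c : bool) : Z :=
  match a, b, c with
  | true, false, true => 5 | true, true, false => -5
  | false, true, false => 1 | false, false, true => -1
  | _, _, _ => 0
  end.
Definition cherry_form (a b c : bool) : Z :=
  match a, b, c with
  | true, true, true => 4 | true, true, false => -4
  | true, false, false | false, true, false => 1
  | false, false, false => -2
  | _, _, _ => 0
  end.

(* [tij] is the value for a root adjacent to [i] of two vertices, which are
   adjacent to each other iff [j = 1]. *)
Definition vertex_form (t00 t01 t10 t11 t20 t21 : Z) (a b c : bool) : Z :=
  match a, b, c with
  | false, false, false => t00 | false, false, true => t01
  | true, true, false => t20 | true, true, true => t21
  | _, _, false => t10 | _, _, true => t11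
  end.
Definition vertex_form1 := vertex_form (-7) 17 3 (-1) 15 (-7).
Definition vertex_form2 := vertex_form 1 1 3 (-5) 3 1.
Definition vertex_form3 := vertex_form 0 0 1 (-1) 1 0.


(* 8640 = 32 * 270. Each product of two values of a form becomes a square once
   summed over the vertices 3, 4 (over 1, 2, 3, 4 for [vertex_form]). *)
Definition cert (l : seq bool) : Z :=
  match l with
  | [:: a01; a02; a12; a03; a13; a23; a04; a14; a24; a34] =>
    let sq f := f a03 a13 a23 * f a04 a14 a24 in
    let sq' f := f a01 a02 a12 * f a03 a04 a34 in
    270 - ((if [&& a01, a02, a12, a23, ~~ a03 & ~~ a13] then 8640 else 0)
      + 144 * (if [&& ~~ a01, ~~ a02 & ~~ a12] then sq cotriangle_form1 else 0)
      + 45 * (if [&& ~~ a01, ~~ a02 & ~~ a12] then sq cotriangle_form2 else 0)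
      + 288 * (if [&& ~~ a01, ~~ a02 & a12] then sq edge_form else 0)
      + 180 * (if [&& ~~ a01, a02 & a12] then sq cherry_form else 0)
      + 5 * sq' vertex_form1 + 25 * sq' vertex_form2 + 360 * sq' vertex_form3)
  | _ => 0
  end.

Fixpoint bitseqs (n : nat) : seq (seq bool) :=
  if n is n'.+1 then [seq b :: l | b <- [:: true; false], l <- bitseqs n']
  else [:: [::]].

(** Written with [foldr] because a big operator is locked against evaluation; [symcert_ge0]
    identifies the two. *)
Definition symcert (r : seq (seq nat)) (l : seq bool) : Z :=
  foldr (fun p z => cert [seq nth false l k | k <- p] + z) 0 r.

(* The [let] makes [vm_compute] evaluate the 120 relabellings only once. *)
Lemma symcert_check :
  let r := relabellings in all (fun l => 0 <=? symcert r l) (bitseqs 10%N).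
Proof. by vm_compute. Qed.

End Certificate.

Lemma mem_bitseqs n (l : seq bool) : size l = n -> l \in bitseqs n.
Proof.
elim: n l => [|n IH] [|b l] //= [/IH ln].
by rewrite mem_cat; case: b; rewrite ?map_f ?orbT // cats0 map_f ?orbT.
Qed.

Lemma symcert_ge0 l : size l = 10%N ->
  0 <= \sum_(p <- relabellings) cert [seq nth false l k | k <- p].
Proof.
move=> sl; have /allP/(_ l (mem_bitseqs sl)) := symcert_check.
by rewrite /symcert unlock => /Z.leb_le/Zle_is_le_bool.
Qed.

(** * Sums over tuples and iterated sums of squares *)

Lemma big_tuple_cons (R : nmodType) (V : finType) n (F : seq V -> R) :
  \sum_(x : n.+1.-tuple V) F x = \sum_a \sum_(x : n.-tuple V) F (a :: x).
Proof.
rewrite pair_big /=.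
rewrite (reindex (fun p : V * n.-tuple V => [tuple of p.1 :: p.2])) //=.
exists (fun x : n.+1.-tuple V => (thead x, [tuple of behead x])) => /=.
  by move=> [a x] _ /=; congr (_, _); apply: val_inj.
by move=> x _; rewrite [in RHS](tuple_eta x); apply: val_inj.
Qed.

Lemma big_tuple_nil (R : nmodType) (V : finType) (F : seq V -> R) :
  \sum_(x : 0.-tuple V) F x = F [::].
Proof.
rewrite (big_pred1 [tuple]) // => x.
by apply/esym/eqP/val_inj; case: x => -[].
Qed.

(** Permuting positions is injective on tuples, as each position occurs in [s]; hence it is a
    bijection of a finite set. *)
Lemma big_tuple_perm (R : nmodType) (V : finType) (x0 : V) n (s : seq nat)
    (F : seq V -> R) : perm_eq s (iota 0 n) ->
  \sum_(x : n.-tuple V) F x = \sum_(x : n.-tuple V) F [seq nth x0 x i | i <- s].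
Proof.
move=> sP; have ss : size s = n by rewrite (perm_size sP) size_iota.
have sz (x : n.-tuple V) : size [seq nth x0 x i | i <- s] == n.
  by rewrite size_map ss.
rewrite (reindex_inj (h := fun x => Tuple (sz x))) //.
move=> x y /(congr1 val)/= exy; apply: val_inj.
apply: (@eq_from_nth _ x0) => [|i]; rewrite !size_tuple // => ilt.
have ins : i \in s by rewrite (perm_mem sP) mem_iota.
have := congr1 (fun t => nth x0 t (index i s)) exy.
by rewrite /= !(nth_map 0%N) ?index_mem // nth_index.
Qed.

Section IteratedSum.
Context {V : finType}.
Implicit Types F : V -> V -> V -> V -> V -> Z.

Definition sum5 F : Z := \sum_a \sum_b \sum_c \sum_d \sum_e F a b c d e.

Lemma sum5_tuple (f : seq V -> Z) :
  \sum_(x : 5.-tuple V) f x = sum5 (fun a b c d e => f [:: a; b; c; d; e]).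
Proof.
rewrite big_tuple_cons; apply: eq_bigr => a _.
rewrite (big_tuple_cons _ (fun x => f (a :: x))); apply: eq_bigr => b _.
rewrite (big_tuple_cons _ (fun x => f [:: a, b & x])); apply: eq_bigr => c _.
rewrite (big_tuple_cons _ (fun x => f [:: a, b, c & x])); apply: eq_bigr => d _.
rewrite (big_tuple_cons _ (fun x => f [:: a, b, c, d & x])); apply: eq_bigr => e _.
by rewrite (big_tuple_nil (fun x => f [:: a, b, c, d, e & x])).
Qed.

Lemma eq_sum5 F F' : (forall a b c d e, F a b c d e = F' a b c d e) -> sum5 F = sum5 F'.
Proof. by move=> FF'; do 5![apply: eq_bigr => ? _]. Qed.

Lemma sum5D F F' :
  sum5 (fun a b c d e => F a b c d e + F' a b c d e) = sum5 F + sum5 F'.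
Proof. by rewrite /sum5 -big_split; do 4![apply: eq_bigr => ? _; rewrite -big_split]. Qed.

Lemma sum5N F : sum5 (fun a b c d e => - F a b c d e) = - sum5 F.
Proof. by rewrite /sum5 -sumrN; do 4![apply: eq_bigr => ? _; rewrite -sumrN]. Qed.

Lemma sum5Z k F : sum5 (fun a b c d e => k * F a b c d e) = k * sum5 F.
Proof. by rewrite /sum5 mulr_sumr; do 4![apply: eq_bigr => ? _; rewrite mulr_sumr]. Qed.

Lemma sum5_const z : sum5 (fun _ _ _ _ _ => z) = z *+ #|V| ^ 5.
Proof. by rewrite /sum5 !sumr_const -!mulrnA !expnS expn0 muln1 !mulnA. Qed.

(** For fixed [a b c] the sum over [d] and [e] factors into the square of one sum. *)
Lemma sum5_square3_ge0 (T : V -> V -> V -> bool) (f : V -> V -> V -> V -> Z) :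
  0 <= sum5 (fun a b c d e => if T a b c then f a b c d * f a b c e else 0).
Proof.
apply: sumr_ge0 => a _; apply: sumr_ge0 => b _; apply: sumr_ge0 => c _.
case: (T a b c); last by rewrite !big1 // => d _; rewrite big1.
under eq_bigr do rewrite -mulr_sumr.
by rewrite -mulr_suml; exact: sqr_ge0.
Qed.

(** For a fixed root [a] the pairs [b c] and [d e] range independently, which again gives a
    square. *)
Lemma sum5_square1_ge0 (f : V -> V -> V -> Z) :
  0 <= sum5 (fun a b c d e => f a b c * f a d e).
Proof.
apply: sumr_ge0 => a _.
have -> : \sum_b \sum_c \sum_d \sum_e (f a b c * f a d e) = (\sum_b \sum_c f a b c) ^+ 2.
  rewrite expr2 mulr_suml; apply: eq_bigr => b _; rewrite mulr_suml; apply: eq_bigr => c _.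
  rewrite mulr_sumr; apply: eq_bigr => d _; rewrite mulr_sumr; exact: eq_bigr.
exact: sqr_ge0.
Qed.

End IteratedSum.

(** * Induced paws in a finite graph *)

Section PawCount.
Variables (V : finType) (G : rel V).
Hypothesis symG : symmetric G.

Definition induced_paw (a b c d : V) : bool :=
  [&& G a b, G a c, G b c, G c d, ~~ G a d & ~~ G b d].

Definition adjacency (x0 : V) (x : seq V) : seq bool :=
  [seq G (nth x0 x p.1) (nth x0 x p.2) | p <- pairs5].

(** Transfers a permutation of the vertices to the bits; the symmetry of [G] absorbs the reordering
    of pairs in [pair_index]. *)
Lemma adjacency_perm x0 (x : 5.-tuple V) s : perm_eq s (iota 0 5) ->
  adjacency x0 [seq nth x0 x i | i <- s] =
  [seq nth false (adjacency x0 x) k | k <- relabelling s].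
Proof.
move=> sP; have ss : size s = 5 by rewrite (perm_size sP) size_iota.
have us : uniq s by rewrite (perm_uniq sP) iota_uniq.
have lts i : (i < 5)%N -> (nth 0%N s i < 5)%N.
  move=> ilt; have : nth 0%N s i \in s by rewrite mem_nth ?ss.
  by rewrite (perm_mem sP) mem_iota.
have pair_indexP i j : (i < 5)%N -> (j < 5)%N -> i != j ->
    nth false (adjacency x0 x) (pair_index i j) = G (nth x0 x i) (nth x0 x j).
  by case: i => [|[|[|[|[|?]]]]]; case: j => [|[|[|[|[|?]]]]] //= _ _ _; rewrite symG.
rewrite /relabelling -map_comp /adjacency.
apply/eq_in_map => -[i j] /= ij.
have [ilt jlt nij] : [/\ (i < 5)%N, (j < 5)%N & i != j].
  have /allP/(_ _ ij)/and3P[] //: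
    all (fun p => [&& p.1 < 5, p.2 < 5 & p.1 != p.2]%N) pairs5 by [].
rewrite pair_indexP ?lts //; last by rewrite nth_uniq ?ss.
by rewrite !(nth_map 0%N) ?ss.
Qed.

(** Summing over all tuples is invariant under the 120 relabellings, so 120 times the sum is a sum
    of symmetrised certificates. Tuples with repeated vertices, looped or not, are covered too: they
    still yield ten bits, and all bit lists were checked. *)
Lemma sum_cert_ge0 x0 : 0 <= \sum_(x : 5.-tuple V) cert (adjacency x0 x).
Proof.
have E s : s \in permutations (iota 0 5) ->
    \sum_(x : 5.-tuple V) cert (adjacency x0 x) =
    \sum_(x : 5.-tuple V) cert [seq nth false (adjacency x0 x) k | k <- relabelling s].
  rewrite mem_permutations => sP.
  rewrite (big_tuple_perm x0 (s := s) (fun x => cert (adjacency x0 x))) //.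
  by apply: eq_bigr => x _; rewrite adjacency_perm.
suff : 0 <= (\sum_(x : 5.-tuple V) cert (adjacency x0 x)) *+
    size (permutations (iota 0 5)).
  by rewrite pmulrn_lge0 // size_permutations ?iota_uniq.
set r := permutations _; set S := \sum_x _.
have -> : S *+ size r = \sum_(s <- r) S.
  by rewrite big_const_seq count_predT iter_addr_0.
rewrite (eq_big_seq _ E) exchange_big /=; apply: sumr_ge0 => x _.
by have := @symcert_ge0 (adjacency x0 x) erefl; rewrite /relabellings big_map.
Qed.

(** Displays the certificate in the shapes to which [sum5_square3_ge0] and [sum5_square1_ge0]
    apply. *)
Lemma cert_adjacency x0 (a b c d e : V) :
  cert (adjacency x0 [:: a; b; c; d; e]) =
  Zpos 270 - ((if induced_paw a b c d then Zpos 8640 else 0)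
  + Zpos 144 * (if [&& ~~ G a b, ~~ G a c & ~~ G b c] then
      cotriangle_form1 (G a d) (G b d) (G c d) * cotriangle_form1 (G a e) (G b e) (G c e)
    else 0)
  + Zpos 45 * (if [&& ~~ G a b, ~~ G a c & ~~ G b c] then
      cotriangle_form2 (G a d) (G b d) (G c d) * cotriangle_form2 (G a e) (G b e) (G c e)
    else 0)
  + Zpos 288 * (if [&& ~~ G a b, ~~ G a c & G b c] then
      edge_form (G a d) (G b d) (G c d) * edge_form (G a e) (G b e) (G c e)
    else 0)
  + Zpos 180 * (if [&& ~~ G a b, G a c & G b c] then
      cherry_form (G a d) (G b d) (G c d) * cherry_form (G a e) (G b e) (G c e)
    else 0)
  + Zpos 5 * (vertex_form1 (G a b) (G a c) (G b c) * vertex_form1 (G a d) (G a e) (G d e))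
  + Zpos 25 * (vertex_form2 (G a b) (G a c) (G b c) * vertex_form2 (G a d) (G a e) (G d e))
  + Zpos 360 * (vertex_form3 (G a b) (G a c) (G b c) * vertex_form3 (G a d) (G a e) (G d e))).
Proof. by []. Qed.

Lemma induced_paw_count :
  (32 * \sum_a \sum_b \sum_c \sum_d induced_paw a b c d <= #|V| ^ 4)%N.
Proof.
have [V0|/card_gt0P[x0 _]] := posnP #|V|.
  rewrite big1 ?muln0 // => a.
  by suff : a \in pred0 by []; rewrite -(card0_eq V0).
set N := (\sum_a _)%N.
(* The paw indicator ignores the fifth vertex, which contributes a factor [#|V|]. *)
have EN k : sum5 (fun a b c d _ => if induced_paw a b c d then k else 0) =
    k *+ (N * #|V|).
  rewrite [(N * _)%N]mulnC mulrnA /N /sum5.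
  do 4![rewrite -sumrMnr; apply: eq_bigr => ? _].
  by rewrite sumr_const; case: induced_paw; rewrite ?mul0rn.
have := sum_cert_ge0 x0.
rewrite (sum5_tuple (fun x => cert (adjacency x0 x))) (eq_sum5 (cert_adjacency x0)).
rewrite sum5D sum5_const sum5N 7!sum5D EN 7!sum5Z.
have := sum5_square3_ge0 (fun a b c => [&& ~~ G a b, ~~ G a c & ~~ G b c])
  (fun a b c d => cotriangle_form1 (G a d) (G b d) (G c d)).
have := sum5_square3_ge0 (fun a b c => [&& ~~ G a b, ~~ G a c & ~~ G b c])
  (fun a b c d => cotriangle_form2 (G a d) (G b d) (G c d)).
have := sum5_square3_ge0 (fun a b c => [&& ~~ G a b, ~~ G a c & G b c])
  (fun a b c d => edge_form (G a d) (G b d) (G c d)).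
have := sum5_square3_ge0 (fun a b c => [&& ~~ G a b, G a c & G b c])
  (fun a b c d => cherry_form (G a d) (G b d) (G c d)).
have := sum5_square1_ge0 (fun a b c => vertex_form1 (G a b) (G a c) (G b c)).
have := sum5_square1_ge0 (fun a b c => vertex_form2 (G a b) (G a c) (G b c)).
have := sum5_square1_ge0 (fun a b c => vertex_form3 (G a b) (G a c) (G b c)).
do 7!move: (sum5 _) => ?.
have V_gt0 : (0 < #|V|)%N by apply/card_gt0P; exists x0.
(* With [n = #|V|], dropping the seven squares leaves 8640 N n <= 270 n^5, so the goal is multiplied
   by n as well. *)
rewrite -(leq_pmul2r V_gt0) -expnSr -mulnA.
move: (N * _)%N (_ ^ 5)%N => p q.
lia.
Qed.

End PawCount.

(** * From graphs to edge weights in [0, 1] *)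

Section WeightedPaw.
Variables (R : realFieldType) (V : finType).
Implicit Types W : V -> V -> R.

Definition paw_weight W (a b c d : V) : R :=
  W a b * W a c * W b c * W c d * (1 - W a d) * (1 - W b d).

Definition set_edge W (p q : V) (t : R) : V -> V -> R := fun i j =>
  if ((i == p) && (j == q)) || ((i == q) && (j == p)) then t else W i j.

(** Distinct vertices span six different edges, which makes each summand affine in every edge
    weight; with a repetition one edge could occur in several factors. *)
Definition paw_sum W : R := \sum_a \sum_b \sum_c \sum_d
  if uniq [:: a; b; c; d] then paw_weight W a b c d else 0.

(** At most one of the six factors involves the edge [p q], and that factor is affine in [t]. *)
Lemma paw_weight_set_edge W p q t a b c d : uniq [:: a; b; c; d] ->
  paw_weight (set_edge W p q t) a b c d =
  t * paw_weight (set_edge W p q 1) a b c d +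
  (1 - t) * paw_weight (set_edge W p q 0) a b c d.
Proof.
rewrite /= !inE !negb_or !andbT => /and3P[/and3P[ab ac ad] /andP[bc bd] cd].
have neq (x y : V) : x != y -> (x == y = false) * (y == x = false).
  by move=> xy; rewrite [y == x]eq_sym (negbTE xy).
have E := (neq _ _ ab, neq _ _ ac, neq _ _ ad, neq _ _ bc, neq _ _ bd, neq _ _ cd, eqxx).
rewrite /paw_weight /set_edge.
(* Locate [p], then [q], among the four vertices; [E] settles the comparisons between those
   vertices. *)
have [<-|ap] := eqVneq a p; [|have [<-|bp] := eqVneq b p; [|have [<-|cp] := eqVneq c p;
  [|have [_|dp] := eqVneq d p]]]; rewrite ?E ?andbF ?andbT ?orbF /=; last by ring.
all: have [/esym aq|aq] := eqVneq a q; rewrite ?aq ?E /=; first by ring.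
all: have [/esym bq|bq] := eqVneq b q; rewrite ?bq ?E /=; first by ring.
all: have [/esym cq|cq] := eqVneq c q; rewrite ?cq ?E /=; first by ring.
all: by have [/esym dq|dq] := eqVneq d q; rewrite ?dq ?E /=; ring.
Qed.

Lemma paw_sum_set_edge W p q t : paw_sum (set_edge W p q t) =
  t * paw_sum (set_edge W p q 1) + (1 - t) * paw_sum (set_edge W p q 0).
Proof.
rewrite /paw_sum !mulr_sumr -big_split; apply: eq_bigr => a _.
rewrite !mulr_sumr -big_split; apply: eq_bigr => b _.
rewrite !mulr_sumr -big_split; apply: eq_bigr => c _.
rewrite !mulr_sumr -big_split; apply: eq_bigr => d _.
by case: ifP => [/paw_weight_set_edge -> //|_]; rewrite /= !mulr0 addr0.
Qed.

(** The edges of weight 1 form a graph, possibly with loops, which [induced_paw_count] allows;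
    forgetting distinctness only increases the count. *)
Lemma paw_sum01_le W : (forall i j, W i j = W j i) ->
  (forall i j, (W i j == 0) || (W i j == 1)) -> 32%:R * paw_sum W <= #|V|%:R ^+ 4.
Proof.
move=> symW W01; have := @induced_paw_count V (fun i j => W i j == 1).
move=> /(_ (fun i j => congr1 (eq_op^~ 1) (symW i j))).
rewrite -(ler_nat R) natrX natrM; apply: le_trans; rewrite ler_pM2l ?ltr0n//.
rewrite /paw_sum natr_sum; apply: ler_sum => a _.
rewrite natr_sum; apply: ler_sum => b _; rewrite natr_sum; apply: ler_sum => c _.
rewrite natr_sum; apply: ler_sum => d _; case: ifP => _; last exact: ler0n.
have n01 : (0 == 1 :> R) = false by rewrite eq_sym oner_eq0.
rewrite /paw_weight /induced_paw.
case/orP: (W01 a b) => /eqP->; rewrite ?eqxx ?n01 /= ?mul0r ?ler0n //.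
case/orP: (W01 a c) => /eqP->; rewrite ?eqxx ?n01 /= ?mulr0 ?mul0r ?ler0n //.
case/orP: (W01 b c) => /eqP->; rewrite ?eqxx ?n01 /= ?mulr0 ?mul0r ?ler0n //.
case/orP: (W01 c d) => /eqP->; rewrite ?eqxx ?n01 /= ?mulr0 ?mul0r ?ler0n //.
case/orP: (W01 a d) => /eqP->; rewrite ?eqxx ?n01 /= ?subrr ?mulr0 ?mul0r ?ler0n //.
case/orP: (W01 b d) => /eqP->; rewrite ?eqxx ?n01 /= ?subrr ?mulr0 ?ler0n //.
by rewrite subr0 !mulr1.
Qed.

Lemma paw_sum_le W : (forall i j, W i j = W j i) ->
  (forall i j, 0 <= W i j <= 1) -> 32%:R * paw_sum W <= #|V|%:R ^+ 4.
Proof.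
(* Induction on a list [s] of the pairs whose weight may still be fractional. *)
suff H (s : seq (V * V)) : forall W, (forall i j, W i j = W j i) ->
    (forall i j, 0 <= W i j <= 1) ->
    (forall i j, (i, j) \notin s -> (W i j == 0) || (W i j == 1)) ->
    32%:R * paw_sum W <= #|V|%:R ^+ 4.
  by move=> symW W01; apply: (H (enum {: V * V})) => // i j; rewrite mem_enum.
elim: s => [|[p q] s IH] {}W symW W01 Ws.
  by apply: paw_sum01_le => // i j; exact: Ws.
have WE : paw_sum W = paw_sum (set_edge W p q (W p q)).
  rewrite /paw_sum; do 4![apply: eq_bigr => ? _]; rewrite /paw_weight.
  have WE i j : set_edge W p q (W p q) i j = W i j.
    by rewrite /set_edge; case: ifP => // /orP[] /andP[/eqP-> /eqP->]; rewrite // symW.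
  by rewrite !WE.
have bound t : (t == 0) || (t == 1) -> 32%:R * paw_sum (set_edge W p q t) <= #|V|%:R ^+ 4.
  move=> t01; apply: IH => [i j|i j|i j ijs]; rewrite /set_edge.
  - by rewrite [W i j]symW orbC; congr (if _ || _ then _ else _); exact: andbC.
  - by case: ifP => // _; case/orP: t01 => /eqP ->; rewrite !lexx ler01.
  - case: ifPn => // ijpq; apply: Ws; rewrite inE negb_or ijs andbT.
    by apply: contra ijpq => /eqP[-> ->]; rewrite !eqxx.
have /andP[t0 t1] := W01 p q; rewrite WE paw_sum_set_edge.
move: (W p q) (_ ^+ 4) t0 t1 bound => t N t0 t1 bound.
(* By affinity the sum is a convex combination of its values at weights 0 and 1, both bounded by the
   induction hypothesis. *)
have -> : N = t * N + (1 - t) * N by ring.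
rewrite mulrDr mulrCA [X in _ + X]mulrCA.
by apply: lerD; apply: ler_wpM2l; rewrite ?subr_ge0 // bound ?eqxx ?orbT.
Qed.

End WeightedPaw.

(** * Injective subsamples of an independent sample *)

Section Subsample.
Context d (T : measurableType d) (R : realType) (P : probability T R).

Definition box n (A : 'I_n -> set T) : set (n.-tuple T) :=
  [set t | forall i, A i (tnth t i)].

Lemma measurable_box n (A : 'I_n -> set T) :
  (forall i, measurable (A i)) -> measurable (box A).
Proof.
move=> mA; rewrite (_ : box A =
    \bigcap_(i in [set: 'I_n]) ((@tnth _ T ^~ i) @^-1` A i)).
  apply: fin_bigcap_measurable => // i _.
  by rewrite -[X in measurable X]setTI; exact: measurable_tnth.
by apply/seteqP; split=> t /= h i *; exact: h.
Qed.

(** Provides the generators for the uniqueness of measures in [iid_prob_subsample]. *)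
Lemma measurable_tuple_box n : @measurable _ (n.-tuple T) =
  <<s [set B | exists2 A : 'I_n -> set T, forall i, measurable (A i) & B = box A] >>.
Proof.
apply/seteqP; split.
  apply: smallest_sub; first exact: smallest_sigma_algebra.
  rewrite -bigcup_seq => B [/= i _ [C mC <-]].
  (* A coordinate preimage is a box with all other sides full. *)
  apply: sub_sigma_algebra; exists (fun j => if j == i then C else setT).
    by move=> j; case: ifP.
  rewrite setTI; apply/seteqP; split=> t /=.
    by move=> Ct j; case: eqP => [->|].
  by move=> /(_ i); rewrite eqxx.
apply: smallest_sub; first exact: sigma_algebra_measurable.
by move=> _ [A mA ->]; exact: measurable_box.
Qed.

Definition subsample m n (f : 'I_m -> 'I_n) (t : n.-tuple T) : m.-tuple T :=
  [tuple tnth t (f i) | i < m].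

Lemma measurable_subsample m n (f : 'I_m -> 'I_n) :
  measurable_fun [set: n.-tuple T] (subsample f).
Proof.
apply/measurable_fun_tnthP => i.
rewrite (_ : _ \o _ = @tnth _ T ^~ (f i)); first exact: measurable_tnth.
by apply/funext => t /=; rewrite tnth_mktuple.
Qed.

(** Boxes are stable under intersection and generate the sigma-algebra, so agreement of the two laws
    on boxes suffices. *)
Lemma iid_prob_subsample m n (f : 'I_m -> 'I_n) (B : set (m.-tuple T)) :
  injective f -> measurable B ->
  iid_prob P n (subsample f @^-1` B) = iid_prob P m B.
Proof.
move=> f_inj mB.
pose msub := isMeasurableFun.Build _ _ _ _ _ (measurable_subsample f).
pose sub : {mfun n.-tuple T >-> m.-tuple T} := HB.pack (subsample f) msub.
rewrite -[LHS]/(distribution (iid_prob P n) sub B).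
apply: (measure_unique _ (fun=> setT) (measurable_tuple_box m)) => //.
- move=> _ _ [A mA ->] [C mC ->]; exists (fun i => A i `&` C i).
    by move=> i; exact: measurableI.
  apply/seteqP; split=> t /=; first by move=> [h1 h2] i; split.
  by move=> h; split=> i; case: (h i).
- by move=> _; exists (fun=> setT) => //; apply/seteqP; split.
- by rewrite bigcup_const //; exists 0%N.
- move=> _ [A mA ->].
  rewrite /= iid_prob_box //.
  (* The preimage of a box is a box: side [A i] at coordinate [f i], and the full space, of
     probability 1, off the image of [f]. *)
  pose A' j := if [pick i | f i == j] is Some i then A i else setT.
  have A'f i : A' (f i) = A i.
    rewrite /A'; case: pickP => [k /eqP/f_inj -> //|/(_ i)]; by rewrite eqxx.
  rewrite /distribution /pushforward (_ : _ @^-1` _ = box A').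
    rewrite [LHS]iid_prob_box; last by move=> j; rewrite /A'; case: pickP.
    rewrite (bigID (mem (f @: 'I_m)%SET)) /= [X in (_ * X)%E]big1 ?mule1.
      rewrite big_imset /=; last by move=> ? ? _ _; exact: f_inj.
      by apply: eq_big => [i|i _]; rewrite ?A'f ?inE.
    move=> j; rewrite /A'; case: pickP => [i /eqP <-|_ _].
      by rewrite imset_f ?inE.
    exact: probability_setT.
  apply/seteqP; split=> t /= h.
    move=> j; rewrite /A'; case: pickP => // i /eqP <-.
    by have := h i; rewrite tnth_mktuple.
  by move=> i; have := h (f i); rewrite A'f tnth_mktuple.
- move=> _; apply: le_lt_trans (ltry 1).
  exact: (probability_le1 (distribution (iid_prob P n) sub) measurableT).
Qed.

Lemma expectation_subsample m n (f : 'I_m -> 'I_n) (g : m.-tuple T -> R) :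
  injective f -> measurable_fun setT g -> (forall t, 0 <= g t) ->
  ('E_(iid_prob P n)[g \o subsample f] = 'E_(iid_prob P m)[g])%E.
Proof.
move=> f_inj mg g0; rewrite !unlock.
rewrite -(@ge0_integral_pushforward _ _ _ _ _ _ (measurable_subsample f)
  _ setT (EFin \o g)) //.
- apply: eq_measure_integral => mf B mB; last by move=> _; exact: iid_prob_subsample.
  exact: measurable_subsample.
- exact/measurable_EFinP.
- by move=> t _; rewrite lee_fin.
Qed.

End Subsample.

(** * Explicit formulas for the paw *)

Local Notation o0 := (@Ordinal 4 0 isT).
Local Notation o1 := (@Ordinal 4 1 isT).
Local Notation o2 := (@Ordinal 4 2 isT).
Local Notation o3 := (@Ordinal 4 3 isT).

(** Bridges the placements of the paw in a sample and the quadruples of [paw_sum]. *)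
Lemma sum_inj_ffun4 (R : nmodType) (V : finType) (F : V -> V -> V -> V -> R) :
  \sum_(f : {ffun 'I_4 -> V} | injectiveb f)
    F (f o0) (f o1) (f o2) (f o3) =
  \sum_a \sum_b \sum_c \sum_d if uniq [:: a; b; c; d] then F a b c d else 0.
Proof.
rewrite !pair_big /= big_mkcond /=.
rewrite (reindex (fun p : V * V * V * V =>
  [ffun i => tnth [tuple p.1.1.1; p.1.1.2; p.1.2; p.2] i])) /=.
  apply: eq_bigr => -[[[a b] c] d] _ /=; rewrite !ffunE; congr (if _ then _ else _).
  by rewrite /injectiveb /dinjectiveb (eq_map (ffunE _)) map_tnth_enum.
exists (fun f => (f o0, f o1, f o2, f o3)).
  by move=> [[[a b] c] d] _; rewrite !ffunE.
move=> f _; apply/ffunP => i; rewrite ffunE.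
by case: i => [[|[|[|[|//]]]] ?]; rewrite (tnth_nth (f ord0)) /=; congr (f _); apply: val_inj.
Qed.

Lemma ind_weight_paw (R : realType) (w : R * R -> R) (x : 'I_4 -> R) :
  @ind_weight R paw w x = paw_weight (fun i j => w (x i, x j))
    o0 o1 o2 o3.
Proof.
(* On ordinals [enum_rank] preserves the order, so the sixteen ordered pairs can be expanded and the
   six increasing ones remain. *)
have rank_lt (e : paw * paw) :
    (enum_rank e.1 < enum_rank e.2)%N = ((e.1 : 'I_4) < (e.2 : 'I_4))%N.
  by rewrite (enum_rank_ord (e.1 : 'I_4)) (enum_rank_ord (e.2 : 'I_4)).
rewrite /ind_weight.
under eq_bigl do rewrite rank_lt.
under [X in _ * X]eq_bigl do rewrite rank_lt.
rewrite big_mkcond [X in _ * X]big_mkcond /=.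
rewrite -(pair_bigA _ (fun i j : 'I_4 =>
  if (i < j)%N && paw_adj i j then w (x i, x j) else 1)).
rewrite -(pair_bigA _ (fun i j : 'I_4 =>
  if (i < j)%N && ~~ paw_adj i j then 1 - w (x i, x j) else 1)).
rewrite !big_ord_recl !big_ord0 /= /paw_weight.
have -> : o0 = ord0 by exact: val_inj.
have -> : o1 = lift ord0 ord0 by exact: val_inj.
have -> : o2 = lift ord0 (lift ord0 ord0) by exact: val_inj.
have -> : o3 = lift ord0 (lift ord0 (lift ord0 ord0)) by exact: val_inj.
ring.
Qed.

(** * Induced densities of a graphon *)

Section GraphonWeight.
Variables (R : realType) (w : R * R -> R).
Hypothesis gw : @graphon R w.
Local Notation W := (extend0 w).
Local Notation U := (uniform_prob (@ltr01 R)).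

Lemma extend0_sym x y : W (x, y) = W (y, x).
Proof.
case: gw => _ symw _; rewrite /extend0 /patch.
have -> : ((y, x) \in @unit_square R) = ((x, y) \in @unit_square R).
  by apply/idP/idP => /set_mem[? ?]; apply/mem_set.
by case: ifPn => // /set_mem; exact: symw.
Qed.

Lemma extend0_itv p : 0 <= W p <= 1.
Proof.
case: gw => _ _ w01; rewrite /extend0 /patch.
by case: ifPn => [/set_mem/w01//|_]; rewrite lexx ler01.
Qed.

Lemma measurable_extend0 : measurable_fun [set: R * R] W.
Proof.
case: gw => mw _ _; have mD : measurable (@unit_square R) by exact: measurableX.
exact: (measurable_restrictT w mD).1.
Qed.

Lemma ind_weight_itv (H : sgraph) (x : H -> R) : 0 <= ind_weight W x <= 1.
Proof.
have W0 e : 0 <= W e by case/andP: (extend0_itv e).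
have W1 e : W e <= 1 by case/andP: (extend0_itv e).
apply/andP; split; rewrite /ind_weight.
  by apply: mulr_ge0; apply: prodr_ge0 => // e _; rewrite subr_ge0.
apply: mulr_ile1.
- exact: prodr_ge0.
- by apply: prodr_ge0 => e _; rewrite subr_ge0.
- by apply: prodr_ile1 => e _; rewrite W0 W1.
- by apply: prodr_ile1 => e _; rewrite subr_ge0 W1 lerBlDr lerDl W0.
Qed.

Lemma measurable_ind_weight (H : sgraph) n (f : H -> 'I_n) :
  measurable_fun [set: n.-tuple R] (fun t => ind_weight W (fun u => tnth t (f u))).
Proof.
have mW u v :
    measurable_fun [set: n.-tuple R] (fun t => W (tnth t (f u), tnth t (f v))).
  apply: (measurableT_comp measurable_extend0).
  by apply: measurable_fun_pair; exact: measurable_tnth.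
rewrite /ind_weight; apply: measurable_funM.
  under eq_fun do rewrite -big_filter; apply: measurable_prod => e _; exact: mW.
under eq_fun do rewrite -big_filter; apply: measurable_prod => e _.
by apply: measurable_funB => //; exact: mW.
Qed.

(** Every injective placement of the vertices of [H] in a larger sample has the same expected
    weight. *)
Lemma expectation_ind_weight (H : sgraph) n (f : H -> 'I_n) : injective f ->
  ('E_(iid_prob U n)[fun t => ind_weight W (fun u => tnth t (f u))] = t_ind H w)%E.
Proof.
move=> f_inj; pose g (t : #|H|.-tuple R) :=
  ind_weight W (fun u : H => tnth t (enum_rank u)).
rewrite -[RHS](@expectation_subsample _ _ _ U _ _ (f \o enum_val) g).
- congr expectation; apply/funext => t /=; rewrite /g.
  by congr ind_weight; apply/funext => u; rewrite tnth_mktuple /= enum_rankK.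
- exact: (inj_comp f_inj enum_val_inj).
- exact: measurable_ind_weight.
- by move=> t; case/andP: (ind_weight_itv (fun u : H => tnth t (enum_rank u))).
Qed.

Lemma t_ind_fin (H : sgraph) :
  t_ind H w = (fine (t_ind H w))%:E /\ 0 <= fine (t_ind H w) <= 1.
Proof.
have w01 (t : #|H|.-tuple R) := ind_weight_itv (fun u : H => tnth t (enum_rank u)).
have t0 : (0 <= t_ind H w)%E.
  by apply: expectation_ge0 => t; case/andP: (w01 t).
have t1 : (t_ind H w <= 1)%E.
  rewrite -(expectation_cst (iid_prob U #|H|) 1); apply: expectation_le => //.
  - exact: measurable_ind_weight.
  - by move=> t; case/andP: (w01 t).
  - by apply: aeW => t; case/andP: (w01 t).
have tf : t_ind H w \is a fin_num by rewrite ge0_fin_numE // (le_lt_trans t1) ?ltry.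
by rewrite fineK //; split=> //; rewrite -!lee_fin fineK // t0 t1.
Qed.

End GraphonWeight.

(** * The upper bound 1/32 *)

Section UpperBound.
Variables (R : realType) (w : R * R -> R).
Hypothesis gw : @graphon R w.
Local Notation W := (extend0 w).
Local Notation U := (uniform_prob (@ltr01 R)).

Lemma sampled_paw_le n (x : n.-tuple R) :
  \sum_(f : {ffun 'I_4 -> 'I_n} | injectiveb f)
    @ind_weight R paw W (fun u => tnth x (f u)) <= n%:R ^+ 4 / 32.
Proof.
under eq_bigr do rewrite ind_weight_paw.
rewrite (sum_inj_ffun4 (paw_weight (fun i j => W (tnth x i, tnth x j)))).
rewrite ler_pdivlMr ?ltr0n // mulrC -[n in leRHS]card_ord.
apply: paw_sum_le => i j; [exact: extend0_sym|exact: extend0_itv].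
Qed.

(** Integrate [sampled_paw_le]: each of the [n ^_ 4] injections contributes the density. *)
Lemma t_ind_paw_ffact n : fine (t_ind paw w) * (n ^_ 4)%:R <= n%:R ^+ 4 / 32.
Proof.
pose F (f : {ffun 'I_4 -> 'I_n}) (x : n.-tuple R) :=
  @ind_weight R paw W (fun u => tnth x (f u)).
have F0 f x : 0 <= F f x by case/andP: (ind_weight_itv gw (fun u : paw => tnth x (f u))).
have mF f : measurable_fun setT (F f) by exact: measurable_ind_weight.
have mEF f : measurable_fun setT (EFin \o F f) by exact/measurable_EFinP.
have : (\int[iid_prob U n]_x
          (\sum_(f : {ffun 'I_4 -> 'I_n} | injectiveb f) (F f x)%:E) <=
        \int[iid_prob U n]_x (n%:R ^+ 4 / 32)%:E)%E.
  apply: ge0_le_integral => //.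
  - by move=> x _; apply: sume_ge0 => f _; rewrite lee_fin.
  - under eq_fun do rewrite -big_filter.
    exact: emeasurable_sum.
  - by move=> x _; rewrite sumEFin lee_fin; exact: sampled_paw_le.
under eq_integral do rewrite -big_filter.
rewrite ge0_integral_sum //; last by move=> f x _; rewrite lee_fin.
rewrite big_filter integral_cst //= probability_setT mule1.
have E (f : {ffun 'I_4 -> 'I_n}) : injectiveb f ->
    (\int[iid_prob U n]_x (F f x)%:E = (fine (t_ind paw w))%:E)%E.
  move=> /injectiveP f_inj; rewrite -(t_ind_fin gw paw).1.
  by rewrite -(@expectation_ind_weight _ _ gw paw n f f_inj) unlock.
rewrite (eq_bigr _ E) sumEFin lee_fin sumr_const mulr_natr.
by rewrite -cardsE card_inj_ffuns !card_ord.
Qed.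

Lemma t_ind_paw_le : (t_ind paw w <= (1 / 32)%:E)%E.
Proof.
have [tE /andP[r0 r1]] := t_ind_fin gw paw; rewrite tE lee_fin.
set r := fine _ in r0 r1 *.
(* Take n = k + 3, so that [n ^_ 4] is at least k^4. The excess (k + 3)^4 - k^4 is at most 255 k^3
   for k >= 1, since 12 + 54 + 108 + 81 = 255. *)
have rk (k : nat) : (0 < k)%N -> (32 * r - 1) * k%:R <= 255.
  move=> k0; have h2 := t_ind_paw_ffact (k + 3).
  have h1 : (k%:R ^+ 4 : R) <= ((k + 3) ^_ 4)%:R.
    rewrite -natrX ler_nat !expnS expn0 !ffactnS ffactn0.
    by rewrite !muln1; apply: leq_mul; [lia|apply: leq_mul; [lia|apply: leq_mul; lia]].
  have h3 : r * k%:R ^+ 4 <= (k%:R + 3) ^+ 4 / 32.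
    by apply: (le_trans (ler_wpM2l r0 h1)); rewrite -natrD.
  have y1 : (1 : R) <= k%:R by rewrite ler1n.
  move: (k%:R) y1 h3 => y y1 h3 {h1 h2}.
  have : ((32 * r - 1) * y) * y ^+ 3 <= 255 * y ^+ 3.
    have y2 : y ^+ 2 <= y ^+ 3 by rewrite ler_weXn2l.
    have y3 : y <= y ^+ 3 by rewrite -[leLHS]expr1 ler_weXn2l.
    have y4 : 1 <= y ^+ 3 by rewrite exprn_ege1.
    have E1 : (y + 3) ^+ 4 = y ^+ 4 + 12 * y ^+ 3 + 54 * y ^+ 2 + 108 * y + 81 by ring.
    have E2 : ((32 * r - 1) * y) * y ^+ 3 = 32 * (r * y ^+ 4) - y ^+ 4 by ring.
    rewrite E2; lra.
  by rewrite ler_pM2r // exprn_gt0 // (lt_le_trans ltr01).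
rewrite leNgt; apply/negP => r_gt.
have e_gt0 : 0 < 32 * r - 1 by lra.
(* An integer k exceeding 255 / (32 r - 1) contradicts [rk]. *)
have := rk (Num.trunc (255 / (32 * r - 1))).+1 isT.
rewrite leNgt mulrC -ltr_pdivrMr //.
by rewrite truncnS_gt.
Qed.

End UpperBound.

(** * The extremal graphon *)

Section LowerBound.
Variable R : realType.
Local Notation U := (uniform_prob (@ltr01 R)).

Lemma uniform_prob_itv (a b : R) : 0 <= a -> a <= b -> b <= 1 ->
  U `[a, b[%classic = (b - a)%:E.
Proof.
move=> a0 ab b1; rewrite /uniform_prob integral_uniform_pdf setIidl; last first.
  move=> x /=; rewrite !in_itv /= => /andP[ax xb].
  by rewrite (le_trans a0 ax) (le_trans (ltW xb) b1).
rewrite (eq_integral (cst 1%:E)); last first.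
  move=> x /set_mem /=; rewrite in_itv /= => /andP[ax xb].
  by rewrite /uniform_pdf (le_trans a0 ax) (le_trans (ltW xb) b1) subr0 invr1.
rewrite integral_cst //= mul1e lebesgue_measure_itv /= lte_fin.
by case: ltP => // ba; rewrite (@le_anti _ _ a b) ?ab // subrr.
Qed.

(** Half-open quarters are disjoint; the first four leave out only the point 1 of the unit
    interval. *)
Definition cell (k : nat) : set R := `[k%:R / 4, k.+1%:R / 4[.

Lemma cell_inj x j k : cell j x -> cell k x -> j = k.
Proof.
rewrite /cell /= !in_itv /= => /andP[h1 h2] /andP[h3 h4].
have := le_lt_trans h1 h4; have := le_lt_trans h3 h2.
by rewrite !ltr_pM2r ?invr_gt0 ?ltr0n // !ltr_nat; lia.
Qed.

Lemma cell_prob k : (k < 4)%N -> U (cell k) = (4^-1)%:E.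
Proof.
move=> k4; rewrite /cell uniform_prob_itv ?divr_ge0 ?ler0n //.
- by rewrite -mulrBl -natrB // subSnn mul1r.
- by rewrite ler_pM2r ?invr_gt0 ?ltr0n // ler_nat.
- by rewrite ler_pdivrMr ?ltr0n // mul1r ler_nat.
Qed.

Definition nonadjacent_cells : seq (nat * nat) := [:: (0, 1); (1, 0); (2, 3); (3, 2)]%N.

Definition nonedges : set (R * R) :=
  \bigcup_(e in [set` nonadjacent_cells]) (cell e.1 `*` cell e.2).

(* The 0/1 graphon whose complement joins the cells 0, 1 and the cells 2, 3. *)
Definition extremal : R * R -> R := \1_(~` nonedges).

Lemma extremal_cell j k x y : cell j x -> cell k y ->
  extremal (x, y) = ((j, k) \notin nonadjacent_cells)%:R.
Proof.
move=> jx ky; rewrite /extremal indicE; congr (_ %:R); congr nat_of_bool.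
apply/idP/idP => [/set_mem /= N|jk].
  by apply: contra_notN N => jk; exists (j, k).
apply/mem_set => -[[j' k'] /= jk' [/= /(cell_inj jx) ej /(cell_inj ky) ek]].
by move: jk; rewrite ej ek jk'.
Qed.

Lemma graphon_extremal : graphon extremal.
Proof.
split.
- apply: measurable_funTS; apply: measurable_indic; apply: measurableC.
  apply: fin_bigcup_measurable; first exact: finite_seq.
  by move=> e _; apply: measurableX; exact: measurable_itv.
- move=> x y _; rewrite /extremal !indicE; congr (_ %:R); congr nat_of_bool.
  have sub u v : nonedges (u, v) -> nonedges (v, u).
    move=> [[j k] /= jk [/= ju kv]]; exists (k, j) => //=.
    by move: jk; rewrite !inE => /or4P[] /eqP[-> ->].
  by apply/idP/idP => /set_mem /= N; apply/mem_set => /= /sub.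
- by move=> p _; rewrite /extremal indicE; case: (_ \in _); rewrite ?lexx ?ler01.
Qed.

(* The cells that can hold the vertices 0, 1, 2, 3 of an induced paw. *)
Definition paw_cells : seq (seq nat) :=
  [:: [:: 1; 1; 2; 0]; [:: 1; 1; 3; 0]; [:: 0; 0; 2; 1]; [:: 0; 0; 3; 1];
      [:: 3; 3; 0; 2]; [:: 3; 3; 1; 2]; [:: 2; 2; 0; 3]; [:: 2; 2; 1; 3]]%N.

Lemma paw_cells_lt4 q i : q \in paw_cells -> (nth 0 q i < 4)%N.
Proof.
move=> qQ.
have /allP/(_ _ qQ)/(all_nthP 0%N) H : all (all (fun k => k < 4)%N) paw_cells by [].
by have [/H //|?] := ltnP i (size q); rewrite nth_default.
Qed.

Definition cell_box (q : seq nat) : set (4.-tuple R) :=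
  box (fun i : 'I_4 => cell (nth 0%N q i)).

Lemma cell_sub k x : (k < 4)%N -> cell k x -> 0 <= x <= 1.
Proof.
move=> k4; rewrite /cell /= in_itv /= => /andP[h1 h2]; apply/andP; split.
  by apply: le_trans h1; rewrite divr_ge0 ?ler0n.
by apply: (le_trans (ltW h2)); rewrite ler_pdivrMr ?ltr0n // mul1r ler_nat.
Qed.

(** The graphon is constant on products of cells, which leaves a finite check on the eight
    assignments. *)
Lemma ind_weight_cell_box q t : q \in paw_cells -> cell_box q t ->
  @ind_weight R paw (extend0 extremal) (tnth t) = 1.
Proof.
move=> qQ qt; rewrite ind_weight_paw /paw_weight.
have E i j : extend0 extremal (tnth t i, tnth t j) =
    ((nth 0 q i, nth 0 q j) \notin nonadjacent_cells)%:R.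
  rewrite /extend0 /patch ifT; first exact: extremal_cell.
  apply/mem_set; split; rewrite /= in_itv /=; apply: cell_sub (qt _);
  exact: paw_cells_lt4.
rewrite !E /=; move: qQ; rewrite !inE.
by do 7?[case/orP]; move=> /eqP-> /=; rewrite ?(subr0, mulr1).
Qed.

(** The eight boxes are disjoint, the weight is 1 on each of them, and it is nonnegative
    elsewhere. *)
Lemma sum_cell_box_le t : \sum_(q <- paw_cells) \1_(cell_box q) t <=
  @ind_weight R paw (extend0 extremal) (tnth t).
Proof.
have [[q qQ qt]|nQ] := pselect (exists2 q, q \in paw_cells & cell_box q t); last first.
  rewrite big_seq big1 => [|q qQ]; last first.
    by rewrite indicE memNset // => qt; apply: nQ; exists q.
  by case/andP: (ind_weight_itv graphon_extremal (tnth t : paw -> R)).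
rewrite (ind_weight_cell_box qQ qt) (bigD1_seq q) //= big_seq_cond big1 => [|q'].
  by rewrite addr0 indicE; case: (_ \in _).
case/andP=> q'Q; apply: contraNeq; rewrite indicE => q't.
have {}q't : cell_box q' t.
  by apply: contrapT => q't0; move: q't; rewrite memNset // eqxx.
have sz p : p \in paw_cells -> size p = 4%N.
  by move=> pQ; have /allP/(_ _ pQ)/eqP : all (fun p => size p == 4%N) paw_cells by [].
apply/eqP/(@eq_from_nth _ 0%N); rewrite !sz // => i i4.
exact: cell_inj (q't (Ordinal i4)) (qt (Ordinal i4)).
Qed.

Lemma measurable_cell_box q : measurable (cell_box q).
Proof. by apply: measurable_box => i; exact: measurable_itv. Qed.

Lemma cell_box_prob q : q \in paw_cells -> iid_prob U 4 (cell_box q) = (256^-1)%:E.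
Proof.
move=> qQ; rewrite /cell_box iid_prob_box; last by move=> i; exact: measurable_itv.
rewrite (eq_bigr (fun=> (4^-1)%:E)) => [|i _]; last exact/cell_prob/paw_cells_lt4.
rewrite !big_ord_recl big_ord0 mule1 -!EFinM; congr _%:E; lra.
Qed.

(** Eight boxes of probability 4^-4 have total mass 8 / 256 = 1 / 32. *)
Lemma t_ind_paw_extremal_ge : ((1 / 32)%:E <= t_ind paw extremal)%E.
Proof.
rewrite -(@expectation_ind_weight _ _ graphon_extremal paw 4 id (fun _ _ => id)).
have -> : ((1 / 32)%:E = 'E_(iid_prob U 4)[fun t =>
    (\sum_(q <- paw_cells) \1_(cell_box q) t)%R])%E.
  rewrite unlock; under eq_integral do rewrite -sumEFin.
  rewrite ge0_integral_sum //.
  - have I q : q \in paw_cells ->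
        (\int[iid_prob U 4]_t (\1_(cell_box q) t)%:E = (256^-1)%:E)%E.
      move=> qQ; rewrite integral_indic ?setIT //; last exact: measurable_cell_box.
      exact: cell_box_prob.
    rewrite (eq_big_seq _ I) !big_cons big_nil /= -!EFinD; congr _%:E; lra.
  - move=> q; apply/measurable_EFinP; apply: measurable_indic; exact: measurable_cell_box.
apply: expectation_le.
- apply: measurable_sum => q; apply: measurable_indic; exact: measurable_cell_box.
- exact: (measurable_ind_weight graphon_extremal).
- by move=> t; apply: sumr_ge0.
- by move=> t; case/andP: (ind_weight_itv graphon_extremal (tnth t : paw -> R)).
- by apply: aeW => t; exact: sum_cell_box_le.
Qed.

End LowerBound.

Theorem theorem1 (R : realType) :
  max_t_ind R paw = (1 / 32)%:E /\
  is_max (t_ind paw @` @graphon R) (1 / 32)%:E.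
Proof.
have ub : ubound (t_ind paw @` @graphon R) (1 / 32)%:E.
  by move=> _ [w gw <-]; exact: t_ind_paw_le.
have attained : (t_ind paw @` @graphon R) (1 / 32)%:E.
  exists (@extremal R); first exact: graphon_extremal.
  apply/le_anti; rewrite t_ind_paw_extremal_ge t_ind_paw_le //.
  exact: graphon_extremal.
split; last by [].
by apply/le_anti; rewrite ge_ereal_sup // ereal_sup_ubound.
Qed.
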